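(* Let $\mathcal{N}\to\mathcal{E}\xrightarrow{j}\mathcal{G}$ be a groupoid extension and let $\{R_\lambda\}_{\lambda\in\Lambda}$ be a family of unital rings, where $\Lambda$ indexes the partition $\{S_\lambda\}_{\lambda\in\Lambda}$ of $\mathcal{G}^{(0)}$ with respect to the equivalence relation $\sim_{\mathcal{G}}$. Let $k:\mathcal{G}\to\mathcal{E}$ be a normalized section for $j$, let $(L,\sigma)$ be the associated factor system for $(\mathcal{G},\mathcal{N})$, and let $(M,\tau)$ be the factor system for $(\mathcal{G},\mathcal{R})$ associated with $\{R_\lambda\}_{\lambda\in\Lambda}$ and $(L,\sigma)$. Finally, let $(M',\tau')$ be the trivial factor system for $(\mathcal{E},\mathcal{R}')$ associated with $\mathcal{E}$ and $\{R_\lambda\}_{\lambda\in\Lambda}$. Then the groupoid crossed products $\mathcal{R}\times_{(M,\tau)}\mathcal{G}$ and $\mathcal{R}'\times_{(M',\tau')}\mathcal{E}$ are isomorphic (as rings).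
   Context: Groupoids are purely algebraic (no topology). A groupoid $\mathcal{G}$ has unit space $\mathcal{G}^{(0)}\subseteq\mathcal{G}$ and range and source maps $r,s$; $xy$ is defined iff $s(x)=r(y)$; $\mathcal{G}^{(n)}$ is the set of $n$-tuples with $s(x_i)=r(x_{i+1})$. A group (resp. unital ring) bundle over $\mathcal{G}^{(0)}$ is a set with a map $p$ to $\mathcal{G}^{(0)}$ whose fibres are groups (resp. unital rings). A group bundle is a groupoid over $\mathcal{G}^{(0)}$ (identify the identity of the fibre at $u$ with $u$; $r=s=p$). Extension. A groupoid extension $\mathcal{N}\to\mathcal{E}\xrightarrow{j}\mathcal{G}$ of $\mathcal{G}$ by a group bundle $\mathcal{N}$ over $\mathcal{G}^{(0)}$ (fibres $N_u$) is a surjective groupoid homomorphism $j:\mathcal{E}\to\mathcal{G}$, where $\mathcal{E}$ is a groupoid with unit space $\mathcal{G}^{(0)}$, $j$ is the identity on $\mathcal{G}^{(0)}$, and $\mathcal{N}=\{e\in\mathcal{E}: j(e)\in\mathcal{G}^{(0)}\}$. A normalized section is a map $k:\mathcal{G}\to\mathcal{E}$ with $j\circ k=\mathrm{id}_{\mathcal{G}}$ and $k|_{\mathcal{G}^{(0)}}=\mathrm{id}$. Its associated factor system $(L,\sigma)$ consists of the group isomorphisms $L_x:N_{s(x)}\to N_{r(x)}$, $L_x(n)=k(x)nk(x)^{-1}$, and the map $\sigma:\mathcal{G}^{(2)}\to\mathcal{N}$, $\sigma(x,y)\in N_{r(x)}$, determined by $k(x)k(y)=\sigma(x,y)k(xy)$.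 Partition. For $u,v\in\mathcal{G}^{(0)}$ write $u\sim_{\mathcal{G}}v$ if there is $x\in\mathcal{G}$ with $s(x)=u$, $r(x)=v$. Its classes are $S_\lambda$, $\lambda\in\Lambda$; using $\mathcal{E}$ instead of $\mathcal{G}$ yields the same partition. Factor systems for ring bundles and crossed products. For a groupoid $\mathcal{H}$ and a unital ring bundle $\mathcal{Q}$ over $\mathcal{H}^{(0)}$ with fibres $Q_u$, a factor system for $(\mathcal{H},\mathcal{Q})$ is a pair $(M,\tau)$ of ring isomorphisms $M_x:Q_{s(x)}\to Q_{r(x)}$ ($x\in\mathcal{H}$), $M_u=\mathrm{id}$ for units $u$, and units $\tau(x,y)\in Q_{r(x)}^\times$ for $(x,y)\in\mathcal{H}^{(2)}$, with $\tau(x,s(x))=\tau(r(x),x)=1_{Q_{r(x)}}$, such that $M_xM_y(n)=\tau(x,y)M_{xy}(n)\tau(x,y)^{-1}$ and $\tau(x,y)\tau(xy,z)=M_x(\tau(y,z))\tau(x,yz)$. The crossed product $\mathcal{Q}\times_{(M,\tau)}\mathcal{H}$ is the ring of finitely supported functions $f:\mathcal{H}\to\mathcal{Q}$ with $f(x)\in Q_{r(x)}$, with pointwise sum and product $(fg)(z)=\sum_{xy=z}f(x)M_x(g(y))\tau(x,y)$. The two factor systems. (1) For $u\in S_\lambda$ put $R_u:=R_\lambda[N_u]$ (the group ring, viewed as finitely supported functions $N_u\to R_\lambda$ with convolution) and $\mathcal{R}:=\bigcup_{u}R_u$. Then $M_x(f):=f\circ L_x^{-1}$ and $\tau(x,y):=\delta_{\sigma(x,y)}$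 (the characteristic function of $\{\sigma(x,y)\}$) is the factor system for $(\mathcal{G},\mathcal{R})$ associated with $\{R_\lambda\}$ and $(L,\sigma)$. (2) For $u\in S_\lambda$ put $R'_u:=R_\lambda$ and $\mathcal{R}':=\bigcup_u R'_u$ (a bundle over $\mathcal{E}^{(0)}=\mathcal{G}^{(0)}$). Then $M'_x:=\mathrm{id}:R'_{s(x)}\to R'_{r(x)}$ for $x\in\mathcal{E}$ and $\tau'(x,y):=1_{R'_{r(x)}}$ for $(x,y)\in\mathcal{E}^{(2)}$ is the trivial factor system for $(\mathcal{E},\mathcal{R}')$. *)

(* Defs.v *)
From HB Require Import structures.
From mathcomp Require Import all_boot all_algebra finmap.
From mathcomp Require Import boolp classical_sets functions cardinality fsbigop.

Set Implicit Arguments.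
Unset Strict Implicit.
Unset Printing Implicit Defensive.

Import GRing.Theory.
Local Open Scope classical_set_scope.
Local Open Scope ring_scope.

Lemma finite_setE (T : choiceType) (S : set T) : finite_set S ->
  exists A : {fset T}, forall x, x \notin A -> ~ S x.
Proof. by move=> /finite_fsetP[A ->]; exists A => x /negP. Qed.

Section FinSuppSums.
Context {T : choiceType} {V : zmodType}.
Implicit Types (F : T -> V) (A : {fset T}).

Lemma fsumE F A : (forall x, x \notin A -> F x = 0) ->
  \sum_(x \in [set: T]) F x = \sum_(x <- A) F x.
Proof. exact: fsbigTE. Qed.

Lemma fsum1 F a : (forall x, x != a -> F x = 0) ->
  \sum_(x \in [set: T]) F x = F a.
Proof.
move=> F0; rewrite (@fsumE _ [fset a]%fset) ?big_seq_fset1//.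
by move=> x; rewrite inE => /F0.
Qed.

End FinSuppSums.

Record group_ring (R : pzRingType) (N : groupType) := GroupRing {
  grval :> N -> R;
  gr_finsupp : finite_set [set n | grval n != 0] }.

HB.instance Definition _ R N := gen_eqMixin (group_ring R N).
HB.instance Definition _ R N := gen_choiceMixin (group_ring R N).

Section GroupRing.
Context {R : pzRingType} {N : groupType}.
Implicit Types f g h : group_ring R N.

Lemma grP f g : (forall n, f n = g n) -> f = g.
Proof.
case: f g => [f fP] [g gP] /= /funext fg; rewrite fg in fP *.
by congr GroupRing; exact: Prop_irrelevance.
Qed.

Lemma gr_suppP f : exists A : {fset N}, forall x, x \notin A -> f x = 0.
Proof.
have [A fA] := finite_setE (gr_finsupp f).
by exists A => x /fA/negP/negPn/eqP.
Qed.

Lemma gr_fin (F : N -> R) (A : {fset N}) : (forall x, x \notin A -> F x = 0) ->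
  finite_set [set n | F n != 0].
Proof.
move=> F0; apply: sub_finite_set (finite_fset A) => n /= Fn.
by apply: contraNT Fn => /F0->.
Qed.

Fact gr0_fin : finite_set [set n : N | (0 : R) != 0].
Proof. by apply: (@gr_fin (fun=> 0) fset0). Qed.
Definition gr0 : group_ring R N := GroupRing gr0_fin.

Fact gropp_fin f : finite_set [set n | - f n != 0].
Proof.
have [A fA] := gr_suppP f.
by apply: (@gr_fin (fun n => - f n) A) => x /fA->; rewrite oppr0.
Qed.
Definition gropp f := GroupRing (gropp_fin f).

Fact gradd_fin f g : finite_set [set n | f n + g n != 0].
Proof.
have [A fA] := gr_suppP f; have [B gB] := gr_suppP g.
apply: (@gr_fin (fun n => f n + g n) (A `|` B)%fset) => x.
by rewrite in_fsetU => /norP[/fA-> /gB->]; rewrite addr0.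
Qed.
Definition gradd f g := GroupRing (gradd_fin f g).

Fact graddA : associative gradd.
Proof. by move=> f g h; apply: grP => n /=; rewrite addrA. Qed.
Fact graddC : commutative gradd.
Proof. by move=> f g; apply: grP => n /=; rewrite addrC. Qed.
Fact gradd0 : left_id gr0 gradd.
Proof. by move=> f; apply: grP => n /=; rewrite add0r. Qed.
Fact graddN : left_inverse gr0 gropp gradd.
Proof. by move=> f; apply: grP => n /=; rewrite addNr. Qed.
HB.instance Definition _ := GRing.isZmodule.Build (group_ring R N)
  graddA graddC gradd0 graddN.

Definition conv f g (n : N) : R :=
  \sum_(p \in [set p : N * N | p.1 * p.2 = n]%g) f p.1 * g p.2.

Lemma convr f g n :
  conv f g n = \sum_(b \in [set: N]) f (n / b)%g * g b.
Proof.
rewrite /conv (reindex_fsbig (fun b : N => (n / b, b)%g) setT)//.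
split=> [b _ /=|b c _ _ [_ ->]//|[a b] /= <-]; first by rewrite mulgVK.
by exists b; rewrite ?mulgK.
Qed.

Lemma convl f g n :
  conv f g n = \sum_(a \in [set: N]) f a * g (a^-1 * n)%g.
Proof.
rewrite /conv (reindex_fsbig (fun a : N => (a, a^-1 * n)%g) setT)//.
split=> [b _ /=|b c _ _ [->]//|[a b] /= <-]; first by rewrite mulVKg.
by exists a; rewrite ?mulKg.
Qed.

Lemma convE f g (B : {fset N}) n : (forall b, b \notin B -> g b = 0) ->
  conv f g n = \sum_(b <- B) f (n / b)%g * g b.
Proof. by move=> gB; rewrite convr (fsumE (A := B))// => b /gB->; rewrite mulr0. Qed.

Fact grmul_fin f g : finite_set [set n | conv f g n != 0].
Proof.
have [A fA] := gr_suppP f; have [B gB] := gr_suppP g.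
apply: (@gr_fin _ [fset (a * b)%g | a in A, b in B]%fset) => n nAB.
rewrite (convE _ _ gB) big1_seq// => b /andP[_ bB].
rewrite fA ?mul0r//; apply: contra nAB => nbA.
by apply/imfset2P; exists (n / b)%g => //; exists b => //; rewrite mulgVK.
Qed.
Definition grmul f g : group_ring R N := GroupRing (grmul_fin f g).

Fact grdelta_fin (m : N) : finite_set [set n | (n == m)%:R != 0 :> R].
Proof.
apply: (@gr_fin (fun n => (n == m)%:R) [fset m]%fset) => x.
by rewrite inE => /negbTE->.
Qed.
Definition grdelta m : group_ring R N := GroupRing (grdelta_fin m).

Lemma grmul_deltal m f n : grmul (grdelta m) f n = f (m^-1 * n)%g.
Proof.
rewrite /= convl (fsum1 (a := m)) /= ?eqxx ?mul1r// => a /negbTE->.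
by rewrite mul0r.
Qed.

Lemma grmul_deltar m f n : grmul f (grdelta m) n = f (n / m)%g.
Proof.
rewrite /= convr (fsum1 (a := m)) /= ?eqxx ?mulr1// => a /negbTE->.
by rewrite mulr0.
Qed.

Lemma grmul_delta2 m n : grmul (grdelta m) (grdelta n) = grdelta (m * n)%g.
Proof.
apply: grP => a; rewrite grmul_deltal /=.
by congr ((_ : bool)%:R); apply/eqP/eqP => [<-|->]; rewrite ?mulKg ?mulVKg.
Qed.

Fact grmulA : associative grmul.
Proof.
move=> f g h; apply: grP => n /=.
have [B gB] := gr_suppP g; have [C hC] := gr_suppP h.
have ghD b : b \notin [fset (a * c)%g | a in B, c in C]%fset ->
  grmul g h b = 0.
  move=> bD /=; rewrite (convE _ _ hC) big1_seq// => c /andP[_ cC].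
  rewrite gB ?mul0r//; apply: contra bD => bcB.
  by apply/imfset2P; exists (b / c)%g => //; exists c => //; rewrite mulgVK.
rewrite (convE _ _ ghD) (convE _ _ hC) /=.
under eq_bigr => b _ do rewrite (convE _ _ hC) mulr_sumr.
rewrite exchange_big /=; apply: eq_big_seq => c cC.
rewrite (convE _ _ gB) mulr_suml -fsumE => [|b bD]; last first.
  rewrite gB ?mul0r ?mulr0//; apply: contra bD => bcB.
  by apply/imfset2P; exists (b / c)%g => //; exists c => //; rewrite mulgVK.
rewrite (@reindex_fsbigT _ _ _ _ _ (fun b => b * c)%g); last first.
  by exists (fun b => b / c)%g => b; rewrite ?mulgK ?mulgVK.
rewrite (fsumE (A := B)) => [|b bB]; last by rewrite mulgK gB ?mul0r ?mulr0.
by apply: eq_bigr => b _; rewrite mulgK mulrA invgM mulgA.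
Qed.

Fact grmul1 : left_id (grdelta 1%g) grmul.
Proof. by move=> f; apply: grP => n; rewrite grmul_deltal invg1 mul1g. Qed.
Fact grmulr1 : right_id (grdelta 1%g) grmul.
Proof. by move=> f; apply: grP => n; rewrite grmul_deltar divg1. Qed.

Fact grmulDl : left_distributive grmul +%R.
Proof.
move=> f g h; apply: grP => n /=; have [C hC] := gr_suppP h.
rewrite !(convE _ _ hC) -big_split /=.
by apply: eq_bigr => c _; rewrite mulrDl.
Qed.

Fact grmulDr : right_distributive grmul +%R.
Proof.
move=> h f g; apply: grP => n /=.
have [A fA] := gr_suppP f; have [B gB] := gr_suppP g.
have fAB x : x \notin (A `|` B)%fset -> f x = 0.
  by rewrite in_fsetU => /norP[/fA].
have gAB x : x \notin (A `|` B)%fset -> g x = 0.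
  by rewrite in_fsetU => /norP[_ /gB].
rewrite (convE _ _ fAB) (convE _ _ gAB) (@convE _ (f + g) (A `|` B)%fset).
  by rewrite -big_split; apply: eq_bigr => b _ /=; rewrite mulrDr.
by move=> b bAB /=; rewrite fAB// gAB// addr0.
Qed.

HB.instance Definition _ := GRing.Zmodule_isPzRing.Build (group_ring R N)
  grmulA grmul1 grmulr1 grmulDl grmulDr.

End GroupRing.

HB.mixin Record Zmodule_isRng A of GRing.Zmodule A := {
  rngmul : A -> A -> A;
  rngmulA : associative rngmul;
  rngmulDl : left_distributive rngmul +%R;
  rngmulDr : right_distributive rngmul +%R
}.

(* Rings without a required identity: a crossed product over a groupoid with
   infinitely many objects need not have one. *)
#[short(type="rngType")]
HB.structure Definition Rng := { A of Zmodule_isRng A & GRing.Zmodule A }.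

Definition rng_isomorphic (A B : rngType) : Prop :=
  exists2 phi : {additive A -> B},
    bijective phi & {morph phi : x y / rngmul x y}.

(* [hom u v] is the set of elements with source [u] and range [v], so that
   [gcomp x y] is the product x y, defined when s(x) = r(y); the unit space is
   [U], [u] being identified with [gid u]. *)
Record groupoid (U : choiceType) := Groupoid {
  hom : U -> U -> choiceType;
  gid : forall u, hom u u;
  gcomp : forall u v w, hom v w -> hom u v -> hom u w;
  ginv : forall u v, hom u v -> hom v u;
  gcompA : forall u v w t (x : hom w t) (y : hom v w) (z : hom u v),
    gcomp x (gcomp y z) = gcomp (gcomp x y) z;
  gid_l : forall u v (x : hom u v), gcomp (gid v) x = x;
  gid_r : forall u v (x : hom u v), gcomp x (gid u) = x;
  ginv_l : forall u v (x : hom u v), gcomp (ginv x) x = gid u;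
  ginv_r : forall u v (x : hom u v), gcomp x (ginv x) = gid v
}.

Arguments gid {U} _ u.
Arguments gcomp {U g u v w} x y.
Arguments ginv {U g u v} x.

Notation "x ** y" := (gcomp x y) (at level 40, left associativity).

Section GroupoidTheory.
Context {U : choiceType} {G : groupoid U}.

Lemma gcompK u v w (x : hom G v w) (y : hom G u v) : ginv x ** (x ** y) = y.
Proof. by rewrite gcompA ginv_l gid_l. Qed.

Lemma gcompVK u v w (x : hom G w v) (y : hom G u v) : x ** (ginv x ** y) = y.
Proof. by rewrite gcompA ginv_r gid_l. Qed.

Lemma gcompKr u v w (x : hom G v w) (y : hom G u v) : x ** y ** ginv y = x.
Proof. by rewrite -gcompA ginv_r gid_r. Qed.

Lemma gcompVKr u v w (x : hom G v w) (y : hom G v u) : x ** ginv y ** y = x.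
Proof. by rewrite -gcompA ginv_l gid_r. Qed.

Lemma gcompI u v w (x : hom G v w) : injective (fun y : hom G u v => x ** y).
Proof. by move=> y z /(congr1 (fun t => ginv x ** t)); rewrite !gcompK. Qed.

Lemma gcompIr u v w (y : hom G u v) : injective (fun x : hom G v w => x ** y).
Proof. by move=> x z /(congr1 (fun t => t ** ginv y)); rewrite !gcompKr. Qed.

Lemma ginvM u v w (x : hom G v w) (y : hom G u v) : ginv (x ** y) = ginv y ** ginv x.
Proof. by apply: (gcompI (x := x ** y)); rewrite ginv_r gcompA gcompKr ginv_r. Qed.

Lemma ginv1 u : ginv (gid G u) = gid G u.
Proof. by apply: (gcompI (x := gid G u)); rewrite ginv_r gid_l. Qed.

Lemma ginvK u v (x : hom G u v) : ginv (ginv x) = x.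
Proof. by apply: (gcompI (x := ginv x)); rewrite ginv_r ginv_l. Qed.

End GroupoidTheory.

(* A unit of R together with its two-sided (hence unique) inverse. *)
Record ring_unit (R : pzRingType) := RingUnit {
  uval : R;
  uinv : R;
  umulrV : uval * uinv = 1;
  umulVr : uinv * uval = 1
}.

Record factor_system (U : choiceType) (G : groupoid U) (Q : U -> pzRingType) :=
  FactorSystem {
  fs_map : forall u v, hom G u v -> {rmorphism Q u -> Q v};
  fs_tau : forall u v w, hom G v w -> hom G u v -> ring_unit (Q w);
  fs_map_bij : forall u v (x : hom G u v), bijective (fs_map x);
  fs_map1 : forall u (n : Q u), fs_map (gid G u) n = n;
  fs_tau1r : forall u v (x : hom G u v), uval (fs_tau x (gid G u)) = 1;
  fs_tau1l : forall u v (x : hom G u v), uval (fs_tau (gid G v) x) = 1;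
  fs_mapM : forall u v w (x : hom G v w) (y : hom G u v) (n : Q u),
    fs_map x (fs_map y n) =
      uval (fs_tau x y) * fs_map (x ** y) n * uinv (fs_tau x y);
  fs_cocycle : forall u v w t
      (x : hom G w t) (y : hom G v w) (z : hom G u v),
    uval (fs_tau x y) * uval (fs_tau (x ** y) z) =
      fs_map x (uval (fs_tau y z)) * uval (fs_tau x (y ** z))
}.

Arguments fs_map {U G Q} f {u v} x.
Arguments fs_tau {U G Q} f {u v w} x y.

Notation arrow G := {p : _ * _ & hom G p.1 p.2}.
Notation arrow_from G u := {w : _ & hom G u w}.
(* pairs (x, y) with s(x) = r(y), s(y) = u and r(x) = v *)
Notation composable G u v :=
  {w : _ & (hom G w v * hom G u w)%type}.

Record crossed_product (U : choiceType) (G : groupoid U) (Q : U -> pzRingType)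
    (F : factor_system G Q) := CrossedProduct {
  cpval : forall u v, hom G u v -> Q v;
  cp_finsupp : finite_set [set a : arrow G | cpval (tagged a) != 0]
}.
Arguments cpval {U G Q F} c {u v} x.

HB.instance Definition _ U G Q F := gen_eqMixin (@crossed_product U G Q F).
HB.instance Definition _ U G Q F := gen_choiceMixin (@crossed_product U G Q F).

Section CrossedProduct.
Context {U : choiceType} {G : groupoid U} {Q : U -> pzRingType}.
Context {F : factor_system G Q}.
Local Notation M := (fs_map F).
Local Notation tau := (fs_tau F).
Implicit Types f g h : crossed_product F.

Lemma cpP f g : (forall u v (x : hom G u v), cpval f x = cpval g x) -> f = g.
Proof.
case: f g => [f fP] [g gP] /= fg.
have {}fg : f = g.
  by apply: functional_extensionality_dep => u;
     apply: functional_extensionality_dep => v; apply: funext => x.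
rewrite fg in fP *; congr CrossedProduct; exact: Prop_irrelevance.
Qed.

Definition arr u v (x : hom G u v) : arrow G :=
  @Tagged _ (u, v) (fun p => hom G p.1 p.2) x.
Definition arr_from u v (x : hom G u v) : arrow_from G u :=
  Tagged (fun w => hom G u w) x.


Lemma arr_inj u : injective (fun b : arrow_from G u => arr (tagged b)).
Proof.
move=> [w b] [w' b'] /= E; have [Ew] := congr1 tag E.
by subst w'; rewrite (eq_from_Tagged E).
Qed.

Lemma arr_from_supp f u : exists B : {fset arrow_from G u},
  forall b, b \notin B -> cpval f (tagged b) = 0.
Proof.
have fin : finite_set [set b : arrow_from G u | cpval f (tagged b) != 0].
  pose h (b : arrow_from G u) := arr (tagged b).
  apply: (@finite_preimage _ _ _ h _ (cp_finsupp f)).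
  by move=> b c _ _; exact: arr_inj.
by have [B fB] := finite_setE fin; exists B => b /fB/negP/negPn/eqP.
Qed.

Lemma cp_suppP f : exists A : {fset arrow G},
  forall u v (x : hom G u v), arr x \notin A -> cpval f x = 0.
Proof.
have [A fA] := finite_setE (cp_finsupp f).
by exists A => u v x /fA/negP/negPn/eqP.
Qed.

Lemma cp_fin (f : forall u v, hom G u v -> Q v) (A : {fset arrow G}) :
  (forall u v (x : hom G u v), arr x \notin A -> f u v x = 0) ->
  finite_set [set a : arrow G | f _ _ (tagged a) != 0].
Proof.
move=> f0; apply: sub_finite_set (finite_fset A) => -[[u v] x] /= fx.
by apply: contraNT fx => /f0->.
Qed.

Fact cp0_fin :
  finite_set [set a : arrow G | (0 : Q (tag a).2) != 0].
Proof. exact: (@cp_fin (fun _ _ _ => 0) fset0). Qed.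
Definition cp0 : crossed_product F :=
  @CrossedProduct U G Q F (fun _ _ _ => 0) cp0_fin.

Fact cpopp_fin f :
  finite_set [set a : arrow G | - cpval f (tagged a) != 0].
Proof.
have [A fA] := cp_suppP f.
by apply: (@cp_fin (fun u v x => - cpval f x) A) => u v x /fA->; rewrite oppr0.
Qed.
Definition cpopp f : crossed_product F :=
  @CrossedProduct U G Q F (fun _ _ x => - cpval f x) (cpopp_fin f).

Fact cpadd_fin f g :
  finite_set [set a : arrow G | cpval f (tagged a) + cpval g (tagged a) != 0].
Proof.
have [A fA] := cp_suppP f; have [B gB] := cp_suppP g.
apply: (@cp_fin (fun u v x => cpval f x + cpval g x) (A `|` B)%fset) => u v x.
by rewrite in_fsetU => /norP[/fA-> /gB->]; rewrite addr0.
Qed.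
Definition cpadd f g : crossed_product F :=
  @CrossedProduct U G Q F (fun _ _ x => cpval f x + cpval g x) (cpadd_fin f g).

Fact cpaddA : associative cpadd.
Proof. by move=> f g h; apply: cpP => u v x /=; rewrite addrA. Qed.
Fact cpaddC : commutative cpadd.
Proof. by move=> f g; apply: cpP => u v x /=; rewrite addrC. Qed.
Fact cpadd0 : left_id cp0 cpadd.
Proof. by move=> f; apply: cpP => u v x /=; rewrite add0r. Qed.
Fact cpaddN : left_inverse cp0 cpopp cpadd.
Proof. by move=> f; apply: cpP => u v x /=; rewrite addNr. Qed.
HB.instance Definition _ := GRing.isZmodule.Build (crossed_product F)
  cpaddA cpaddC cpadd0 cpaddN.

Definition cpconv f g u v (z : hom G u v) : Q v :=
  \sum_(p \in [set p : composable G u v | (tagged p).1 ** (tagged p).2 = z])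
    cpval f (tagged p).1 * M (tagged p).1 (cpval g (tagged p).2)
      * uval (tau (tagged p).1 (tagged p).2).

Lemma cpconvr f g u v (z : hom G u v) : cpconv f g z =
  \sum_(b \in [set: arrow_from G u])
    cpval f (z ** ginv (tagged b)) * M (z ** ginv (tagged b)) (cpval g (tagged b))
      * uval (tau (z ** ginv (tagged b)) (tagged b)).
Proof.
rewrite /cpconv.
pose h (b : arrow_from G u) : composable G u v :=
  @Tagged _ (tag b) (fun w => (hom G w v * hom G u w)%type)
    (z ** ginv (tagged b), tagged b).
rewrite (reindex_fsbig h setT)//; split=> [b _ /=|b c _ _|].
- by rewrite gcompVKr.
- by move=> /(congr1 (fun p : composable G u v => arr_from (tagged p).2)); case: b c => [? ?] [? ?].
move=> [w [x y]] /= xyz; exists (arr_from y) => //.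
by rewrite /h /= -xyz gcompKr.
Qed.

Lemma cpconvE f g u v (z : hom G u v) (B : {fset arrow_from G u}) :
  (forall b, b \notin B -> cpval g (tagged b) = 0) ->
  cpconv f g z = \sum_(b <- B)
    cpval f (z ** ginv (tagged b)) * M (z ** ginv (tagged b)) (cpval g (tagged b))
      * uval (tau (z ** ginv (tagged b)) (tagged b)).
Proof.
move=> gB; rewrite cpconvr (fsumE (A := B))// => b /gB->.
by rewrite rmorph0 mulr0 mul0r.
Qed.

(* a finite set of arrows containing all products of arrows from A and B *)
Lemma prod_finset (A B : {fset arrow G}) : exists C : {fset arrow G},
  forall u v w (x : hom G v w) (y : hom G u v),
    arr (x ** y) \notin C -> (arr x \notin A) || (arr y \notin B).
Proof.
pose S := [set c : arrow G | exists u v w (x : hom G v w) (y : hom G u v),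
  [/\ arr x \in A, arr y \in B & c = arr (x ** y)]].
have fS : finite_set S.
  pose m (p : arrow G * arrow G) : arrow G :=
    match (tag p.2).2 =P (tag p.1).1 with
    | ReflectT e =>
        arr (tagged p.1 ** ecast v (hom G (tag p.2).1 v) e (tagged p.2))
    | ReflectF _ => p.1
    end.
  apply: (@sub_finite_set _ _ (m @` ([set` A] `*` [set` B]))).
    move=> _ [u [v [w [x [y [xA yB ->]]]]]]; exists (arr x, arr y) => //.
    by rewrite /m /=; case: eqP => // e; rewrite eq_axiomK.
  by apply: finite_image; apply: finite_setX.
have [C SC] := finite_setE fS; exists C => u v w x y /SC nS.
by rewrite -negb_and; apply/negP => /andP[xA yB]; apply: nS; exists u, v, w, x, y.
Qed.

Fact cpmul_fin f g : finite_set [set a : arrow G | cpconv f g (tagged a) != 0].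
Proof.
have [A fA] := cp_suppP f; have [B gB] := cp_suppP g.
have [C ABC] := prod_finset A B.
apply: (@cp_fin (fun u v x => cpconv f g x) C) => u v z zC.
rewrite cpconvr fsbig1// => -[w y] _ /=.
have := ABC _ _ _ (z ** ginv y) y; rewrite gcompVKr => /(_ zC)/orP[/fA->|/gB->].
  by rewrite !mul0r.
by rewrite rmorph0 mulr0 mul0r.
Qed.
Definition cpmul f g : crossed_product F :=
  @CrossedProduct U G Q F (fun _ _ x => cpconv f g x) (cpmul_fin f g).

Lemma tau_twist u v w (x : hom G v w) (y : hom G u v) (n : Q u) :
  M x (M y n) * uval (tau x y) = uval (tau x y) * M (x ** y) n.
Proof. by rewrite fs_mapM -mulrA umulVr mulr1. Qed.

Fact cpmulA : associative cpmul.
Proof.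
move=> f g h; apply: cpP => u v z /=.
have [H hH] := arr_from_supp h u.
have [A gA] := cp_suppP g; have [B hB] := cp_suppP h.
have [C ABC] := prod_finset A B.
pose D := fset_set [set b : arrow_from G u | arr (tagged b) \in C].
have gh0 b : b \notin D -> forall y : arrow_from G u,
    cpval g (tagged b ** ginv (tagged y)) = 0 \/ cpval h (tagged y) = 0.
  move=> bD [w y] /=; have := ABC _ _ _ (tagged b ** ginv y) y.
  rewrite gcompVKr => /(_ _)/orP[|/gA|/hB]; [|by left|by right].
  apply: contra bD => bC; rewrite in_fset_set ?inE//.
  apply: (@finite_preimage _ _ [set` C]) => // b1 b2 _ _; exact: arr_inj.
have ghD b : b \notin D -> cpval (cpmul g h) (tagged b) = 0.
  move=> bD /=; rewrite cpconvr fsbig1// => y _.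
  by have [->|->] := gh0 _ bD y; rewrite ?rmorph0 ?mulr0 !mul0r.
rewrite (cpconvE _ _ ghD) (cpconvE _ _ hH) /=.
under eq_bigr => b _ do
  rewrite (cpconvE _ _ hH) rmorph_sum/= mulr_sumr mulr_suml.
rewrite exchange_big /=; apply: eq_bigr => -[w y] _ /=.
have [K gK] := arr_from_supp g w.
rewrite (cpconvE _ _ gK) !mulr_suml -fsumE => [|b bD]; last first.
  by have [->|/=->] := gh0 _ bD (arr_from y); rewrite !(rmorph0, mulr0, mul0r).
rewrite (@reindex_fsbigT _ _ _ _ _
  (fun a : arrow_from G w => arr_from (tagged a ** y))); last first.
  exists (fun b : arrow_from G u => arr_from (tagged b ** ginv y)) => -[t a] /=.
    by rewrite gcompKr.
  by rewrite gcompVKr.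
rewrite (fsumE (A := K)) => [|b bK]; last first.
  by rewrite /= gcompKr gK// ?(mulr0, mul0r, rmorph0).
apply: eq_bigr => -[t a] _ /=.
rewrite gcompKr ginvM gcompA; set x := z ** ginv y ** ginv a.
have -> : z ** ginv y = x ** a by rewrite gcompVKr.
rewrite !rmorphM /= -!mulrA; do 2 congr (_ * _).
by rewrite -fs_cocycle !mulrA tau_twist.
Qed.

Fact cpmulDl : left_distributive cpmul +%R.
Proof.
move=> f g h; apply: cpP => u v z /=; have [H hH] := arr_from_supp h u.
rewrite !(cpconvE _ _ hH) -big_split /=.
by apply: eq_bigr => b _; rewrite !mulrDl.
Qed.

Fact cpmulDr : right_distributive cpmul +%R.
Proof.
move=> h f g; apply: cpP => u v z /=.
have [A fA] := arr_from_supp f u; have [B gB] := arr_from_supp g u.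
have fAB x : x \notin (A `|` B)%fset -> cpval f (tagged x) = 0.
  by rewrite in_fsetU => /norP[/fA].
have gAB x : x \notin (A `|` B)%fset -> cpval g (tagged x) = 0.
  by rewrite in_fsetU => /norP[_ /gB].
rewrite (cpconvE _ _ fAB) (cpconvE _ _ gAB).
rewrite (@cpconvE _ (f + g) _ _ _ (A `|` B)%fset) => [|b bAB /=]; last first.
  by rewrite fAB// gAB// addr0.
by rewrite -big_split; apply: eq_bigr => b _ /=; rewrite rmorphD mulrDr mulrDl.
Qed.

HB.instance Definition _ := Zmodule_isRng.Build (crossed_product F)
  cpmulA cpmulDl cpmulDr.

End CrossedProduct.

Record extension (U : choiceType) (E G : groupoid U) := Extension {
  ext_proj : forall u v, hom E u v -> hom G u v;
  ext_proj1 : forall u, ext_proj (gid E u) = gid G u;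
  ext_projM : forall u v w (e : hom E v w) (d : hom E u v),
    ext_proj (e ** d) = ext_proj e ** ext_proj d;
  ext_surj : forall u v (x : hom G u v), exists e : hom E u v, ext_proj e = x
}.
Arguments ext_proj {U E G} _ {u v} _.

(* The fibre N_u of the group bundle. Since [ext_proj] is the identity on
   objects, elements with unit image lie in some [hom E u u]. *)
Record kernel (U : choiceType) (E G : groupoid U) (j : extension E G) (u : U) :=
  Kernel { kerval : hom E u u; kerP : ext_proj j kerval == gid G u }.

HB.instance Definition _ U E G j u := [isSub for @kerval U E G j u].
HB.instance Definition _ U E G j u := [Choice of @kernel U E G j u by <:].

Section KernelGroup.
Context {U : choiceType} {E G : groupoid U} {j : extension E G}.

Lemma ker_proj u (n : kernel j u) : ext_proj j (kerval n) = gid G u.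
Proof. exact/eqP/kerP. Qed.

Lemma ext_projV u v (e : hom E u v) : ext_proj j (ginv e) = ginv (ext_proj j e).
Proof.
apply: (gcompI (x := ext_proj j e)).
by rewrite -ext_projM !ginv_r ext_proj1.
Qed.

Fact ker1P u : ext_proj j (gid E u) == gid G u.
Proof. by rewrite ext_proj1. Qed.
Definition ker1 u : kernel j u := Kernel (ker1P u).

Fact kerMP u (m n : kernel j u) : ext_proj j (kerval m ** kerval n) == gid G u.
Proof. by rewrite ext_projM !ker_proj gid_l. Qed.
Definition kerM u (m n : kernel j u) : kernel j u := Kernel (kerMP m n).

Fact kerVP u (n : kernel j u) : ext_proj j (ginv (kerval n)) == gid G u.
Proof. by rewrite ext_projV ker_proj ginv1. Qed.
Definition kerV u (n : kernel j u) : kernel j u := Kernel (kerVP n).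

Fact kerMA u : associative (@kerM u).
Proof. by move=> l m n; apply: val_inj; rewrite /= gcompA. Qed.
Fact ker1M u : left_id (ker1 u) (@kerM u).
Proof. by move=> n; apply: val_inj; rewrite /= gid_l. Qed.
Fact kerM1 u : right_id (ker1 u) (@kerM u).
Proof. by move=> n; apply: val_inj; rewrite /= gid_r. Qed.
Fact kerVM u : left_inverse (ker1 u) (@kerV u) (@kerM u).
Proof. by move=> n; apply: val_inj; rewrite /= ginv_l. Qed.
Fact kerMV u : right_inverse (ker1 u) (@kerV u) (@kerM u).
Proof. by move=> n; apply: val_inj; rewrite /= ginv_r. Qed.

HB.instance Definition _ u := isGroup.Build (kernel j u)
  (@kerMA u) (@ker1M u) (@kerM1 u) (@kerVM u) (@kerMV u).

Lemma kervalM u (m n : kernel j u) : kerval (m * n)%g = kerval m ** kerval n.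
Proof. by []. Qed.
Lemma kervalV u (n : kernel j u) : kerval n^-1%g = ginv (kerval n).
Proof. by []. Qed.
Lemma kerval1 u : kerval (1%g : kernel j u) = gid E u.
Proof. by []. Qed.

End KernelGroup.

Record normalized_section (U : choiceType) (E G : groupoid U)
    (j : extension E G) := NormalizedSection {
  sec : forall u v, hom G u v -> hom E u v;
  secK : forall u v (x : hom G u v), ext_proj j (sec x) = x;
  sec1 : forall u, sec (gid G u) = gid E u
}.
Arguments sec {U E G j} _ {u v} _.

Section SectionFactorSystem.
Context {U : choiceType} {E G : groupoid U} {j : extension E G}.
Variable k : normalized_section j.

Fact sec_L_proof u v (x : hom G u v) (n : kernel j u) :
  ext_proj j (sec k x ** kerval n ** ginv (sec k x)) == gid G v.
Proof. by rewrite !ext_projM ext_projV secK ker_proj gid_r ginv_r. Qed.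
Definition sec_L u v (x : hom G u v) (n : kernel j u) : kernel j v := Kernel (sec_L_proof x n).

Fact sec_Linv_proof u v (x : hom G u v) (n : kernel j v) :
  ext_proj j (ginv (sec k x) ** kerval n ** sec k x) == gid G u.
Proof. by rewrite !ext_projM ext_projV secK ker_proj gid_r ginv_l. Qed.
Definition sec_Linv u v (x : hom G u v) (n : kernel j v) : kernel j u :=
  Kernel (sec_Linv_proof x n).

Lemma sec_LK u v (x : hom G u v) : cancel (sec_L x) (sec_Linv x).
Proof.
by move=> n; apply: val_inj; rewrite /= !gcompA ginv_l gid_l gcompVKr.
Qed.

Lemma sec_LinvK u v (x : hom G u v) : cancel (sec_Linv x) (sec_L x).
Proof.
by move=> n; apply: val_inj; rewrite /= !gcompA ginv_r gid_l gcompKr.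
Qed.

Lemma sec_LM u v (x : hom G u v) : {morph sec_L x : m n / (m * n)%g}.
Proof.
by move=> m n; apply: val_inj; rewrite /= !gcompA gcompVKr.
Qed.

Lemma sec_LinvM u v (x : hom G u v) : {morph sec_Linv x : m n / (m * n)%g}.
Proof.
by move=> m n; apply: val_inj; rewrite /= !gcompA gcompKr.
Qed.

Fact sec_sigma_proof u v w (x : hom G v w) (y : hom G u v) :
  ext_proj j (sec k x ** sec k y ** ginv (sec k (x ** y))) == gid G w.
Proof. by rewrite !ext_projM ext_projV !secK ginv_r. Qed.
Definition sec_sigma u v w (x : hom G v w) (y : hom G u v) : kernel j w :=
  Kernel (sec_sigma_proof x y).

Lemma sec_sigmaE u v w (x : hom G v w) (y : hom G u v) :
  sec k x ** sec k y = kerval (sec_sigma x y) ** sec k (x ** y).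
Proof. by rewrite /= gcompVKr. Qed.

End SectionFactorSystem.

Definition gconnected (U : choiceType) (G : groupoid U) (u v : U) : Prop :=
  exists x : hom G u v, True.

(* Indexed partition into the classes S_l = [set u | orbit u = l]. *)
Record orbit_index (U : choiceType) (G : groupoid U) := OrbitIndex {
  orbit_idx :> Type;
  orbit_of : U -> orbit_idx;
  orbit_of_surj : forall l, exists u, orbit_of u = l;
  orbit_ofP : forall u v, orbit_of u = orbit_of v <-> gconnected G u v
}.
Arguments orbit_of {U G} o u.

Lemma orbit_of_hom (U : choiceType) (G : groupoid U) (I : orbit_index G)
  u v (x : hom G u v) : orbit_of I u = orbit_of I v.
Proof. by apply/orbit_ofP; exists x. Qed.

Section ExtOrbits.
Context {U : choiceType} {E G : groupoid U} (j : extension E G).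

Lemma ext_gconnected u v : gconnected E u v <-> gconnected G u v.
Proof.
split=> -[x _]; first by exists (ext_proj j x).
by have [e _] := ext_surj j x; exists e.
Qed.

Fact ext_orbit_ofP (I : orbit_index G) u v :
  orbit_of I u = orbit_of I v <-> gconnected E u v.
Proof. by rewrite orbit_ofP ext_gconnected. Qed.

Definition ext_orbit_index (I : orbit_index G) : orbit_index E :=
  OrbitIndex (@orbit_of_surj _ _ I) (ext_orbit_ofP I).

End ExtOrbits.

(* The identity of R_l, for an index l written in two provably equal ways. *)
Section RingCast.
Context {I : Type} {R : I -> pzRingType}.

Definition ring_cast l m (e : l = m) (a : R l) : R m :=
  eq_rect l (fun i => R i) a m e.

Fact ring_cast_zmod l m (e : l = m) : zmod_morphism (ring_cast e).
Proof. by case: m / e. Qed.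
Fact ring_cast_monoid l m (e : l = m) : monoid_morphism (ring_cast e).
Proof. by case: m / e. Qed.
HB.instance Definition _ l m (e : l = m) :=
  GRing.isZmodMorphism.Build (R l) (R m) (ring_cast e) (ring_cast_zmod e).
HB.instance Definition _ l m (e : l = m) :=
  GRing.isMonoidMorphism.Build (R l) (R m) (ring_cast e) (ring_cast_monoid e).

Lemma ring_cast_id l (e : l = l) a : ring_cast e a = a.
Proof. by rewrite (Prop_irrelevance e erefl). Qed.

Lemma ring_cast_comp l m n (e : l = m) (e' : m = n) (e'' : l = n) a :
  ring_cast e' (ring_cast e a) = ring_cast e'' a.
Proof. by case: n / e' e'' => e''; case: m / e e'' => e''; rewrite !ring_cast_id. Qed.

Lemma ring_castK l m (e : l = m) : cancel (ring_cast e) (ring_cast (esym e)).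
Proof. by case: m / e. Qed.
Lemma ring_castVK l m (e : l = m) : cancel (ring_cast (esym e)) (ring_cast e).
Proof. by case: m / e. Qed.

Lemma ring_cast_fsum (T : choiceType) l m (e : l = m) (P : set T) (f : T -> R l) :
  ring_cast e (\sum_(t \in P) f t) = \sum_(t \in P) ring_cast e (f t).
Proof. by case: m / e. Qed.

End RingCast.

Definition ring_unit1 (A : pzRingType) : ring_unit A :=
  RingUnit (mulr1 (1 : A)) (mulr1 (1 : A)).

Section TrivialFactorSystem.
Context {U : choiceType} {H : groupoid U} (I : orbit_index H).
Variable R : I -> pzRingType.

Definition trivial_fibre (u : U) : pzRingType := R (orbit_of I u).

Definition trivialM u v (x : hom H u v) :
    {rmorphism trivial_fibre u -> trivial_fibre v} :=
  (ring_cast (orbit_of_hom I x) : {rmorphism R _ -> R _}).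

Definition trivial_tau u v w (x : hom H v w) (y : hom H u v) :
  ring_unit (trivial_fibre w) := ring_unit1 (trivial_fibre w).

Fact trivialM_bij u v (x : hom H u v) : bijective (trivialM x).
Proof.
exact: (Bijective (ring_castK (orbit_of_hom I x))
                  (ring_castVK (orbit_of_hom I x))).
Qed.
Fact trivialM1 u (n : trivial_fibre u) : trivialM (gid H u) n = n.
Proof. exact: (@ring_cast_id I R). Qed.
Fact trivial_tau1r u v (x : hom H u v) : uval (trivial_tau x (gid H u)) = 1.
Proof. by []. Qed.
Fact trivial_tau1l u v (x : hom H u v) : uval (trivial_tau (gid H v) x) = 1.
Proof. by []. Qed.
Fact trivialMM u v w (x : hom H v w) (y : hom H u v) (n : trivial_fibre u) :
  trivialM x (trivialM y n) =
  uval (trivial_tau x y) * trivialM (x ** y) n * uinv (trivial_tau x y).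
Proof.
by rewrite /= mul1r mulr1; exact: (@ring_cast_comp I R).
Qed.
Fact trivial_cocycle u v w t (x : hom H w t) (y : hom H v w) (z : hom H u v) :
  uval (trivial_tau x y) * uval (trivial_tau (x ** y) z) =
  trivialM x (uval (trivial_tau y z)) * uval (trivial_tau x (y ** z)).
Proof. by rewrite /= rmorph1. Qed.

Definition trivial_factor_system : factor_system H trivial_fibre :=
  FactorSystem trivialM_bij trivialM1 trivial_tau1r trivial_tau1l
    trivialMM trivial_cocycle.

End TrivialFactorSystem.

Section AssociatedFactorSystem.
Context {U : choiceType} {E G : groupoid U} {j : extension E G}.
Context (I : orbit_index G).
Variables (R : I -> pzRingType) (k : normalized_section j).

Definition assoc_fibre (u : U) : pzRingType :=
  group_ring (R (orbit_of I u)) (kernel j u).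

Fact twist_fin u v (x : hom G u v) (f : assoc_fibre u) :
  finite_set [set n | ring_cast (R := R) (orbit_of_hom I x) (f (sec_Linv k x n)) != 0].
Proof.
have [A fA] := gr_suppP f.
apply: (@gr_fin _ _ (fun n => ring_cast (orbit_of_hom I x) (f (sec_Linv k x n)))
   (sec_L k x @` A)%fset).
move=> n nA; rewrite fA ?rmorph0//; apply: contra nA => nA.
by apply/imfsetP; exists (sec_Linv k x n); rewrite ?sec_LinvK.
Qed.
(* f o L_x^-1, with values in R_l for the common class l of u and v *)
Definition twist u v (x : hom G u v) (f : assoc_fibre u) : assoc_fibre v :=
  GroupRing (twist_fin x f).

Lemma twistE u v (x : hom G u v) (f : assoc_fibre u) n :
  twist x f n = ring_cast (R := R) (orbit_of_hom I x) (f (sec_Linv k x n)).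
Proof. by []. Qed.

Lemma twist_delta u v (x : hom G u v) n :
  twist x (grdelta n) = grdelta (sec_L k x n).
Proof.
apply: grP => m; rewrite twistE /= rmorph_nat.
by congr ((_ : bool)%:R); apply/eqP/eqP => [<-|->]; rewrite ?sec_LinvK ?sec_LK.
Qed.

Fact twist_zmod u v (x : hom G u v) : zmod_morphism (twist x).
Proof. by move=> f g; apply: grP => n; rewrite /= rmorphB. Qed.

Fact twist_monoid u v (x : hom G u v) : monoid_morphism (twist x).
Proof.
split=> [|f g].
  rewrite [1]/(grdelta 1%g) twist_delta; congr grdelta.
  by apply: val_inj; rewrite /= gid_r ginv_r.
apply: grP => n; rewrite /= !convr ring_cast_fsum.
rewrite (@reindex_fsbigT _ _ _ _ _ (sec_Linv k x)); last first.
  by exists (sec_L k x) => ?; rewrite ?sec_LK ?sec_LinvK.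
apply: eq_fsbigr => m _; rewrite rmorphM /=.
congr (ring_cast _ (f _) * _); apply: val_inj.
by rewrite /= ?ginvM ?ginvK !gcompA gcompKr.
Qed.
HB.instance Definition _ u v (x : hom G u v) :=
  GRing.isZmodMorphism.Build (assoc_fibre u) (assoc_fibre v) (twist x) (twist_zmod x).
HB.instance Definition _ u v (x : hom G u v) :=
  GRing.isMonoidMorphism.Build (assoc_fibre u) (assoc_fibre v) (twist x) (twist_monoid x).

Definition assocM u v (x : hom G u v) :
  {rmorphism assoc_fibre u -> assoc_fibre v} := twist x.

Fact deltaV (A : pzRingType) (N : groupType) (n : N) :
  grdelta n * grdelta n^-1%g = 1 :> group_ring A N.
Proof. by rewrite [LHS]grmul_delta2 mulgV. Qed.
Fact deltaVr (A : pzRingType) (N : groupType) (n : N) :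
  grdelta n^-1%g * grdelta n = 1 :> group_ring A N.
Proof. by rewrite [LHS]grmul_delta2 mulVg. Qed.

Definition delta_unit u (n : kernel j u) : ring_unit (assoc_fibre u) :=
  RingUnit (deltaV _ n) (deltaVr _ n).

Definition assoc_tau u v w (x : hom G v w) (y : hom G u v) :
  ring_unit (assoc_fibre w) := delta_unit (sec_sigma k x y).

Fact assocM_bij u v (x : hom G u v) : bijective (assocM x).
Proof.
have fin (f : assoc_fibre v) :
  finite_set [set n | ring_cast (R := R) (esym (orbit_of_hom I x)) (f (sec_L k x n)) != 0].
  have [A fA] := gr_suppP f.
  apply: (@gr_fin _ _ (fun n => ring_cast (esym (orbit_of_hom I x)) (f (sec_L k x n)))
     (sec_Linv k x @` A)%fset).
  move=> n nA; rewrite fA ?rmorph0//; apply: contra nA => nA.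
  by apply/imfsetP; exists (sec_L k x n); rewrite ?sec_LK.
exists (fun f => GroupRing (fin f)) => f; apply: grP => n /=.
  by rewrite ring_castK sec_LK.
by rewrite ring_castVK sec_LinvK.
Qed.

Fact assocM1 u (f : assoc_fibre u) : assocM (gid G u) f = f.
Proof.
apply: grP => n; rewrite /= ring_cast_id; congr (f _); apply: val_inj.
by rewrite /= sec1 ginv1 gid_r gid_l.
Qed.

Fact assoc_tau1r u v (x : hom G u v) : uval (assoc_tau x (gid G u)) = 1.
Proof.
congr grdelta; apply: val_inj.
by rewrite /= sec1 !gid_r ginv_r.
Qed.
Fact assoc_tau1l u v (x : hom G u v) : uval (assoc_tau (gid G v) x) = 1.
Proof.
congr grdelta; apply: val_inj.
by rewrite /= sec1 !gid_l ginv_r.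
Qed.

Fact assocMM u v w (x : hom G v w) (y : hom G u v) (f : assoc_fibre u) :
  assocM x (assocM y f) =
  uval (assoc_tau x y) * assocM (x ** y) f * uinv (assoc_tau x y).
Proof.
apply: grP => n; rewrite [RHS]grmul_deltar [RHS]grmul_deltal /=.
rewrite (ring_cast_comp _ _ (orbit_of_hom I (x ** y))).
congr (ring_cast _ (f _)); apply: val_inj.
by rewrite /= !(ginvM, ginvK) !gcompA ginv_l gid_l gcompVKr.
Qed.

Fact assoc_cocycle u v w t (x : hom G w t) (y : hom G v w) (z : hom G u v) :
  uval (assoc_tau x y) * uval (assoc_tau (x ** y) z) =
  assocM x (uval (assoc_tau y z)) * uval (assoc_tau x (y ** z)).
Proof.
rewrite /= twist_delta [LHS]grmul_delta2 [RHS]grmul_delta2; congr grdelta.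
apply: val_inj; rewrite /= !gcompA gcompVKr.
by rewrite !gcompVKr.
Qed.

Definition assoc_factor_system : factor_system G assoc_fibre :=
  FactorSystem assocM_bij assocM1 assoc_tau1r assoc_tau1l assocMM assoc_cocycle.

End AssociatedFactorSystem.

(* Main.v *)
Require Import Defs.
From HB Require Import structures.
From mathcomp Require Import all_boot all_algebra finmap.
From mathcomp Require Import boolp classical_sets functions cardinality fsbigop.

(** A normalized section k splits E as a set: each e : u -> v in E is n k(x) for
    exactly one x in G and one n in N_v, namely x = j(e) and
    n = e k(j(e))^-1 ([ker_partK], [ker_part_ker_sec]).  An element f of the
    crossed product over G assigns to x a finitely supported function on
    N_(r(x)), so currying away this last argument turns f into a function on
    the pairs (n, x), that is, on E: (flat f)(n k(x)) = f(x)(n).  This is an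
    additive bijection, as finiteness of the support of f means the same
    before and after currying.

    For multiplicativity, compare (f f')(x)(n) with the product of flat f and
    flat f' at e = n k(x).  The first is a sum over b in G with the source of x
    of group ring convolutions, hence, with y = x b^-1, a double sum over b and
    m of f(y)(n s^-1 L_y(m)^-1) f'(b)(m), where s = sigma(y, b) ([coord_mul]).
    The second is a sum over d in E with the source of e; grouping the d by
    their image b = j(d), they are the m k(b), and the summand is
    (flat f)(e d^-1) (flat f')(d).  The two agree term by term because
    e (m k(b))^-1 = n s^-1 L_y(m)^-1 k(y) ([ker_sec_div]), an identity which
    says that the twists M and tau of the first crossed product are exactly
    those that the multiplication of E produces in the coordinates (n, x). *)

Set Implicit Arguments.
Unset Strict Implicit.
Unset Printing Implicit Defensive.

(* lets [hom] mean the arrows of a groupoid again, not the linear maps *)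
Import Defs.
Import GRing.Theory.
Local Open Scope classical_set_scope.
Local Open Scope ring_scope.

(** * Finitely supported sums and dependent types *)

(** The hypothesis of finite support matters: sums with infinite support are 0
    by convention, and grouping could turn such a sum into a nonzero one. *)
Lemma fsum_fibres (S T : choiceType) (V : zmodType) (h : T -> S) (F : T -> V)
    (A : {fset T}) : (forall t, t \notin A -> F t = 0) ->
  \sum_(t \in [set: T]) F t =
    \sum_(s \in [set: S]) \sum_(t \in [set t | h t = s]) F t.
Proof.
move=> FA.
have fibreE s : \sum_(t \in [set t | h t = s]) F t =
    \sum_(t <- A) (if h t == s then F t else 0).
  rewrite fsbig_mkcond (fsumE (A := A)) => [|t tA]; last first.
    by rewrite /patch FA ?if_same.
  apply: eq_bigr => t _; rewrite /patch; congr (if _ then _ else _).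
  by apply/idP/idP; rewrite inE => /eqP.
rewrite [RHS](eq_fsbigr (fun s =>
  \sum_(t <- A) (if h t == s then F t else 0))); last first.
  by move=> s _; exact: fibreE.
rewrite (fsumE (A := [fset h t | t in A]%fset)) => [|s sA]; last first.
  rewrite big1_seq// => t /andP[_ tA]; case: eqP => // hts.
  by move: sA; rewrite -hts in_imfset.
rewrite (fsumE FA) exchange_big /=; apply: eq_big_seq => t tA.
rewrite -(@fsumE _ _ (fun s => if h t == s then F t else 0)) => [|s sA]; last first.
  by case: eqP => // hts; move: sA; rewrite -hts in_imfset.
by rewrite (fsum1 (a := h t)) ?eqxx// => s; rewrite eq_sym => /negbTE->.
Qed.

(** Without a finite set outside which every F t vanishes, the sum on the left
    would be 0 by convention while the sums of values may be nonzero. *)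
Lemma gr_fsumE (T : choiceType) (A : pzRingType) (N : groupType)
    (F : T -> group_ring A N) (B : {fset T}) n :
  (forall t, t \notin B -> F t = 0) ->
  (\sum_(t \in [set: T]) F t) n = \sum_(t \in [set: T]) F t n.
Proof.
move=> FB; rewrite (fsumE FB) (fsumE (A := B)) => [|t /FB->//].
by elim/big_ind2: _ => // f a g b <- <-.
Qed.

Lemma ring_cast_irrelevance (I : Type) (R : I -> pzRingType) (l m : I)
    (e e' : l = m) (a : R l) : ring_cast e a = ring_cast e' a.
Proof. by rewrite (Prop_irrelevance e e'). Qed.

Lemma arr_hom_inj (U : choiceType) (H : groupoid U) (u v : U) :
  injective (@arr U H u v).
Proof. by move=> x y xy; exact: eq_from_Tagged xy. Qed.

(** * Coordinates on the extension given by a section *)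

Section Decomposition.
Context {U : choiceType} {E G : groupoid U} {j : extension E G}.
Variable k : normalized_section j.

Definition ker_sec u v (n : kernel j v) (x : hom G u v) : hom E u v :=
  kerval n ** sec k x.

Fact ker_part_proof u v (e : hom E u v) :
  ext_proj j (e ** ginv (sec k (ext_proj j e))) == gid G v.
Proof. by rewrite ext_projM ext_projV secK ginv_r. Qed.
Definition ker_part u v (e : hom E u v) : kernel j v := Kernel (ker_part_proof e).

Lemma ker_partK u v (e : hom E u v) : ker_sec (ker_part e) (ext_proj j e) = e.
Proof. exact: gcompVKr. Qed.

Lemma ext_proj_ker_sec u v (n : kernel j v) (x : hom G u v) :
  ext_proj j (ker_sec n x) = x.
Proof. by rewrite ext_projM ker_proj gid_l secK. Qed.

Lemma ker_part_ker_sec u v (n : kernel j v) (x : hom G u v) :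
  ker_part (ker_sec n x) = n.
Proof. by apply: val_inj; rewrite /= ext_proj_ker_sec gcompKr. Qed.

Lemma ker_sec_inj u v (x : hom G u v) :
  injective (fun n : kernel j v => ker_sec n x).
Proof. by move=> m n mn; rewrite -(ker_part_ker_sec m x) mn ker_part_ker_sec. Qed.

(** The element k(x) k(b)^-1 is computed with k(y) k(b) = sigma(y, b) k(x),
    where y b = x = j(e); moving m^-1 from the right of k(y) to its left then
    costs a conjugation by k(y), which is L_y. *)
Lemma ker_sec_div u v w (e : hom E u v) (b : hom G u w) (m : kernel j w) :
  let y := ext_proj j e ** ginv b in
  e ** ginv (ker_sec m b) =
    ker_sec (ker_part e / sec_sigma k y b / sec_L k y m)%g y.
Proof.
move=> y; have yb : y ** b = ext_proj j e by rewrite gcompVKr.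
apply: (gcompIr (y := ker_sec m b)); rewrite gcompVKr.
rewrite /ker_sec !kervalM !kervalV /= yb.
by rewrite !(ginvM, ginvK) !gcompA !gcompVKr.
Qed.

End Decomposition.

(** * Currying as an isomorphism of crossed products *)

Section Isomorphism.
Context {U : choiceType} {E G : groupoid U} {j : extension E G}.
Context {I : orbit_index G}.
Variables (R : I -> pzRingType) (k : normalized_section j).

Local Notation RxG := (crossed_product (assoc_factor_system R k)).
Local Notation RxE :=
  (crossed_product (trivial_factor_system (I := ext_orbit_index j I) R)).
Implicit Types (f : RxG) (g : RxE).

(** Writing the value at n through this function gives the type R_l for the
    orbit l of v, which the two crossed products share. *)
Definition coord f u v (x : hom G u v) (n : kernel j v) : R (orbit_of I v) :=
  grval (cpval f x) n.

Definition flat_val f u v (e : hom E u v) : R (orbit_of I v) :=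
  coord f (ext_proj j e) (ker_part k e).

(** Both arguments of [coord] in [flat_val] depend on e, so the two coordinate
    identities have to be used in this order to stay well typed. *)
Lemma flat_val_ker_sec f u v (n : kernel j v) (x : hom G u v) :
  flat_val f (ker_sec k n x) = coord f x n.
Proof. by rewrite /flat_val ker_part_ker_sec ext_proj_ker_sec. Qed.

(** The support of [flat f] is a finite union of finite sets: for each x in the
    support of f, the n k(x) with n in the support of f(x). *)
Fact flat_fin f : finite_set [set a : arrow E | flat_val f (tagged a) != 0].
Proof.
pose lift (b : arrow G) (n : kernel j (tag b).2) := arr (ker_sec k n (tagged b)).
pose fibre (b : arrow G) := [set n | coord f (tagged b) n != 0].
apply: (@sub_finite_set _ _ (\bigcup_(b in
    [set b : arrow G | cpval f (tagged b) != 0]) (@lift b @` fibre b))).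
  move=> [[u v] e] /= fe; exists (arr (ext_proj j e)).
    by apply: contra_neq fe => fe0; rewrite /flat_val /coord fe0.
  by exists (ker_part k e) => //; rewrite /lift /= ker_partK.
apply: bigcup_finite (cp_finsupp f) _ => b _.
exact: finite_image (gr_finsupp (cpval f (tagged b))).
Qed.
Definition flat f : RxE := @CrossedProduct U E _ _ (@flat_val f) (flat_fin f).

Fact unflat_gr_fin g u v (x : hom G u v) :
  finite_set [set n : kernel j v | cpval g (ker_sec k n x) != 0].
Proof.
apply: (@finite_preimage _ _ _ (fun n => arr (ker_sec k n x)) _ (cp_finsupp g)).
by move=> m n _ _ /arr_hom_inj/ker_sec_inj.
Qed.
Definition unflat_val g u v (x : hom G u v) : assoc_fibre R (j := j) v :=
  GroupRing (unflat_gr_fin g x).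

(** If the function n |-> g(n k(x)) is nonzero, then x is the image under j of
    some point of the support of g. *)
Fact unflat_fin g : finite_set [set b : arrow G | unflat_val g (tagged b) != 0].
Proof.
apply: (@sub_finite_set _ _ ((fun a : arrow E => arr (ext_proj j (tagged a))) @`
    [set a : arrow E | cpval g (tagged a) != 0])).
  move=> [[u v] x] /= gx; apply: contrapT => nx; case/eqP: gx.
  apply: grP => n /=; apply/eqP; apply: contrapT => /negP gn; apply: nx.
  by exists (arr (ker_sec k n x)); rewrite //= ext_proj_ker_sec.
exact: finite_image (cp_finsupp g).
Qed.
Definition unflat g : RxG := @CrossedProduct U G _ _ (@unflat_val g) (unflat_fin g).

Lemma flatK : cancel flat unflat.
Proof.
by move=> f; apply: cpP => u v x; apply: grP => n; exact: flat_val_ker_sec.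
Qed.

Lemma unflatK : cancel unflat flat.
Proof.
by move=> g; apply: cpP => u v e /=; rewrite /flat_val /coord /= ker_partK.
Qed.

Fact flat_zmod : zmod_morphism flat.
Proof. by move=> f g; apply: cpP. Qed.
HB.instance Definition _ := GRing.isZmodMorphism.Build RxG RxE flat flat_zmod.

(** Right multiplication by delta_sigma is a translation, and M_y replaces the
    summation variable in N_(r(y)) by L_y(m), m in N_(s(y)). *)
Lemma coord_mul f f' u v (x : hom G u v) (n : kernel j v) :
  coord (rngmul f f') x n =
    \sum_(b \in [set: arrow_from G u])
      let y := x ** ginv (tagged b) in
      \sum_(m \in [set: kernel j (tag b)])
        coord f y (n / sec_sigma k y (tagged b) / sec_L k y m)%g *
        ring_cast (orbit_of_hom I y) (coord f' (tagged b) m).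
Proof.
have [B f'B] := arr_from_supp f' u.
rewrite [LHS](congr1 (fun c => grval c n) (cpconvr _ _ _)).
rewrite (@gr_fsumE _ _ _ _ B) => [|b /f'B->]; last by rewrite rmorph0 mulr0 mul0r.
apply: eq_fsbigr => b _ /=; set y := x ** ginv (tagged b).
rewrite [LHS]grmul_deltar [LHS]convr.
rewrite (@reindex_fsbigT _ _ _ _ _ (sec_L k y)); last first.
  by exists (sec_Linv k y) => ?; rewrite ?sec_LK ?sec_LinvK.
by apply: eq_fsbigr => m _; rewrite /= sec_LK.
Qed.

(** The product over E is regrouped along d |-> j(d); the fibre over b is
    parametrized by N_w, w the range of b, through m |-> m k(b). *)
Lemma flatM : {morph flat : f f' / rngmul f f'}.
Proof.
move=> f f'; apply: cpP => u v e.
have [B f'B] := arr_from_supp (flat f') u.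
rewrite [LHS]coord_mul [RHS]cpconvr.
rewrite [RHS](@fsum_fibres _ _ _
  (fun d : arrow_from E u => arr_from (ext_proj j (tagged d))) _ B); last first.
  by move=> d /f'B->; rewrite rmorph0 mulr0 mul0r.
apply: eq_fsbigr => -[w b] _ /=.
rewrite [RHS](reindex_fsbig (fun m => arr_from (ker_sec k m b)) setT); last first.
  split=> [m _ /=|m m' _ _ mm'|[t d] /= db].
  - by rewrite ext_proj_ker_sec.
  - by apply: (@ker_sec_inj _ _ _ _ k _ _ b); exact: eq_from_Tagged mm'.
  have tw := congr1 tag db; rewrite /= in tw; subst t.
  have <- : ext_proj j d = b by exact: eq_from_Tagged db.
  by exists (ker_part k d); rewrite ?ker_partK.
apply: eq_fsbigr => m _ /=.
rewrite mulr1 ker_sec_div !flat_val_ker_sec; congr (_ * _).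
exact: (@ring_cast_irrelevance I R).
Qed.

End Isomorphism.

Theorem theorem4p4 (U : choiceType) (E G : groupoid U) (j : extension E G)
    (I : orbit_index G) (R : orbit_idx I -> pzRingType)
    (k : normalized_section j) :
  rng_isomorphic
    (crossed_product (assoc_factor_system R k))
    (crossed_product (trivial_factor_system (I := ext_orbit_index j I) R)).
Proof.
exists (flat (R := R) (k := k)); last exact: flatM.
exact: Bijective (@flatK _ _ _ _ _ R k) (@unflatK _ _ _ _ _ R k).
Qed.
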